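(* The counting modality $C_2(X)$ is not expressible in $\mathit{QTL}$ over the non-negative real line: there is no $\mathit{QTL}$ formula $\varphi$ whose only predicate name is $X$ such that for every set $X\subseteq[0,\infty)$ and every $t\ge 0$, $\varphi$ holds at $t$ in $\langle [0,\infty),<,X\rangle$ if and only if $C_2(X)$ holds at $t$.
   Context: Temporal logic formulas are built by the grammar $\varphi::=\mathit{True}\mid P\mid\neg\varphi\mid\varphi\wedge\varphi\mid O(\varphi_1,\dots,\varphi_k)$, where $P$ ranges over monadic predicate names and $O$ over the modalities of the logic. They are interpreted at points $t$ of a linear order with monadic predicates: $P$ holds at $t$ iff $t\in P$, Booleans as usual, and a modality $O$ with truth table $\overline O(t_0,X_1,\dots,X_k)$ (a monadic predicate-logic formula with one free point variable $t_0$) holds at $t$ iff $\overline O(t, A_{\varphi_1},\dots,A_{\varphi_k})$ is true, where $A_{\varphi_i}$ is the set of points where $\varphi_i$ holds. $\mathit{QTL}$ is the temporal logic with the four modalities: $X\,\mathbf{U}\,Y$ with truth table $\exists t_1(t_0<t_1\wedge Y(t_1)\wedge\forall t(t_0<t<t_1\to X(t)))$; $X\,\mathbf{S}\,Y$ with truth table $\exists t_1(t_1<t_0\wedge Y(t_1)\wedge\forall t(t_1<t<t_0\to X(t)))$; $\Diamond_1 X$ with truth table $\exists t(t_0<t<t_0+1\wedge X(t))$; and $\overleftarrow{\Diamond}_1X$ with truth table $\exists t(t<t_0<t+1\wedge X(t))$. The counting modality $C_n(X)$ holds at $t_0$ iff there are at least $n$ distinct points $t$ with $t_0<t<t_0+1$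 and $X(t)$. *)

(* Defs.v *)
From mathcomp Require Import all_boot all_order all_algebra.
From mathcomp Require Import interval_inference classical_sets reals.

Set Implicit Arguments.
Unset Strict Implicit.
Unset Printing Implicit Defensive.

Import Order.TTheory GRing.Theory Num.Theory.

Local Open Scope classical_set_scope.
Local Open Scope ring_scope.

Section TruthTables.
Context {R : realType}.
Implicit Types (X Y : set {nonneg R}) (t : {nonneg R}).

(* All point quantifiers range over the domain [0, +oo) of the structure. *)
Definition until_table t0 X Y : Prop :=
  exists t1, [/\ t0 < t1, Y t1 & forall t, t0 < t -> t < t1 -> X t].

Definition since_table t0 X Y : Prop :=
  exists t1, [/\ t1 < t0, Y t1 & forall t, t1 < t -> t < t0 -> X t].

(* Points are compared with [t0 + 1] in the ambient field [R]. *)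
Definition diamond1_table t0 X : Prop :=
  exists t, [/\ t0 < t, t%:num < t0%:num + 1 & X t].

Definition past_diamond1_table t0 X : Prop :=
  exists t, [/\ t < t0, t0%:num < t%:num + 1 & X t].

(* An injection from ['I_n] picks [n] pairwise distinct points. *)
Definition counting_table (n : nat) t0 X : Prop :=
  exists f : 'I_n -> {nonneg R}, injective f /\
    forall i, [/\ t0 < f i, (f i)%:num < t0%:num + 1 & X (f i)].

End TruthTables.

Inductive qtl (P : Type) : Type :=
| QTrue
| QPred (p : P)
| QNot (phi : qtl P)
| QAnd (phi psi : qtl P)
| QUntil (phi psi : qtl P)
| QSince (phi psi : qtl P)
| QDiamond1 (phi : qtl P)
| QPastDiamond1 (phi : qtl P).

Arguments QTrue {P}.

Fixpoint holds (R : realType) (P : Type) (I : P -> set {nonneg R})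
    (phi : qtl P) (t : {nonneg R}) {struct phi} : Prop :=
  match phi with
  | QTrue => True
  | QPred p => I p t
  | QNot phi1 => ~ holds I phi1 t
  | QAnd phi1 phi2 => holds I phi1 t /\ holds I phi2 t
  | QUntil phi1 phi2 =>
      until_table t [set u | holds I phi1 u] [set u | holds I phi2 u]
  | QSince phi1 phi2 =>
      since_table t [set u | holds I phi1 u] [set u | holds I phi2 u]
  | QDiamond1 phi1 => diamond1_table t [set u | holds I phi1 u]
  | QPastDiamond1 phi1 => past_diamond1_table t [set u | holds I phi1 u]
  end.

(* Main.v *)
(** Let [X] be the multiples of [2/3].  Consecutive points of [X] are less than
    [1] apart and there are non-points everywhere between them, so far enough
    from [0] every unit interval meets both [X] and its complement, and no
    metric modality can tell where inside it they lie.  By induction, the set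
    defined by a [QTL] formula is, from some time on, one of the four Boolean
    combinations of [X]; the time is needed because near [0] the past
    modalities see the left end of the line.  Yet [C_2(X)] distinguishes
    [2k/3 + 1/6] from [2k/3 + 1/2], neither of which is in [X]. *)

Require Import Defs.
From mathcomp Require Import all_boot all_order all_algebra.
From mathcomp Require Import interval_inference classical_sets boolp reals lra.

Import Order.TTheory GRing.Theory Num.Theory.

Local Open Scope classical_set_scope.
Local Open Scope ring_scope.

(** * Short gaps and eventual determination *)

Lemma ltnngE {R : realType} (t u : {nonneg R}) : (t < u) = (t%:num < u%:num).
Proof. by []. Qed.

Lemma nng_ex {R : realType} (x : R) :
  0 <= x -> exists t : {nonneg R}, t%:num = x.
Proof. by move=> x0; exists (NngNum x0). Qed.

(** All that the induction uses about the grid. The second half starts at 1 because near 0 there may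
    be no earlier point of [X]. *)
Definition short_gaps {R : realType} (X : set {nonneg R}) : Prop :=
  (forall t, exists n, [/\ t < n, n%:num < t%:num + 1, X n &
     forall u, t < u -> u < n -> ~ X u]) /\
  (forall t, 1 <= t%:num -> exists n, [/\ n < t, t%:num < n%:num + 1, X n &
     forall u, n < u -> u < t -> ~ X u]).

Definition determined_from {R : realType} (X A : set {nonneg R})
    (a b : bool) (N : R) : Prop :=
  forall t, N <= t%:num -> (X t -> (A t <-> a)) /\ (~ X t -> (A t <-> b)).

Definition eventually_determined {R : realType} (X A : set {nonneg R}) : Prop :=
  exists a b N, 0 <= N /\ determined_from X A a b N.

Lemma eventually_determined2 {R : realType} {X A B : set {nonneg R}} :
  eventually_determined X A -> eventually_determined X B ->
  exists a b c d N,
    [/\ 0 <= N, determined_from X A a b N & determined_from X B c d N].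
Proof.
move=> [a [b [M [M0 HA]]]] [c [d [N [N0 HB]]]].
exists a, b, c, d, (M + N); split; first by rewrite addr_ge0.
- by move=> t Nt; apply: HA; lra.
- by move=> t Nt; apply: HB; lra.
Qed.

(** Serves all four modalities: they inspect only points other than the current one, so their value
    in the tail does not even depend on whether that point is in [X]. *)
Lemma eventually_constant {R : realType} {X A : set {nonneg R}} {N : R}
    {P : Prop} : 0 <= N -> (forall t, N <= t%:num -> (A t <-> P)) ->
  eventually_determined X A.
Proof.
move=> N0 AP; exists `[< P >], `[< P >], N; split=> // t Nt.
by split=> _; rewrite AP //; split=> /asboolP.
Qed.

(** * Closure under the connectives and modalities *)

Section ShortGaps.
Context {R : realType} {X : set {nonneg R}} (XP : short_gaps X).
Implicit Types (t u w : {nonneg R}) (A B : set {nonneg R}).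

Lemma setC_right t w : t < w -> exists u, [/\ t < u, u < w & ~ X u].
Proof.
rewrite ltnngE => tw; have [n [tn _ _ nX]] := XP.1 t.
rewrite ltnngE in tn; have t0 : 0 <= t%:num :> R by [].
have [nw|wn] := leP n%:num w%:num.
- have [u ue] := @nng_ex R ((t%:num + n%:num) / 2) ltac:(lra).
  by exists u; split; [| |apply: nX]; rewrite ltnngE; lra.
- have [u ue] := @nng_ex R ((t%:num + w%:num) / 2) ltac:(lra).
  by exists u; split; [| |apply: nX]; rewrite ltnngE; lra.
Qed.

Lemma setC_left t (x : R) : 1 <= t%:num -> x < t%:num ->
  exists n u, [/\ n < u, u < t, x < u%:num, t%:num < n%:num + 1 & X n] /\
    forall v, n < v -> v < t -> ~ X v.
Proof.
move=> t1 xt; have [n [nt tn Xn nX]] := XP.2 t t1.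
rewrite ltnngE in nt; exists n.
have n0 : 0 <= n%:num :> R by [].
have [xn|nx] := leP x n%:num.
- have [u ue] := @nng_ex R ((n%:num + t%:num) / 2) ltac:(lra).
  by exists u; split=> //; split=> //; rewrite ?ltnngE; lra.
- have [u ue] := @nng_ex R ((x + t%:num) / 2) ltac:(lra).
  by exists u; split=> //; split=> //; rewrite ?ltnngE; lra.
Qed.

(** Points outside [X] occur right after [t], which forces [b]. Conversely, a witness can be taken
    at the next point [n] of [X] or before it, and up to there only points outside [X] are
    crossed. *)
Lemma until_determined A B :
  eventually_determined X A -> eventually_determined X B ->
  eventually_determined X [set t | until_table t A B].
Proof.
move=> /eventually_determined2 /[apply] -[a [b [c [d [N [N0 HA HB]]]]]].
apply: (eventually_constant (P := b && (d || c)) N0) => t Nt /=.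
have [n [tn _ Xn nX]] := XP.1 t.
have far u : t < u -> N <= u%:num by rewrite ltnngE; lra.
split=> [[w [tw Bw Atw]]|/andP[bT dcT]].
- have [u [tu uw Xu]] := setC_right _ _ tw.
  have -> /= : b by apply/((HA u (far u tu)).2 Xu); apply: Atw.
  have [Xw|Xw] := pselect (X w).
  + by apply/orP; right; apply/((HB w (far w tw)).1 Xw).
  + by apply/orP; left; apply/((HB w (far w tw)).2 Xw).
- have An u : t < u -> u < n -> A u.
    by move=> tu un; apply/((HA u (far u tu)).2 (nX u tu un)).
  case/orP: dcT => [dT|cT].
  + have [u [tu un Xu]] := setC_right _ _ tn.
    exists u; split=> //; first exact/((HB u (far u tu)).2 Xu).
    by move=> v tv vu; apply: An => //; apply: lt_trans un.
  + by exists n; split=> //; apply/((HB n (far n tn)).1 Xn).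
Qed.

Lemma since_determined A B :
  eventually_determined X A -> eventually_determined X B ->
  eventually_determined X [set t | since_table t A B].
Proof.
move=> /eventually_determined2 /[apply] -[a [b [c [d [N [N0 HA HB]]]]]].
(* The last disjunct: [A] holds throughout the tail and [B] nowhere in it, so
   the witness lies in the initial segment. *)
pose early := exists w, [/\ w%:num < N, B w &
  forall u, w < u -> u%:num < N -> A u].
(* From [N + 1] on, the nearest earlier point of [X], less than 1 back, is still in the tail. *)
have N1 : 0 <= N + 1 by lra.
apply: (eventually_constant (P := b /\ (d \/ c \/ (a /\ early))) N1) => t Nt /=.
have t1 : 1 <= t%:num by lra.
split=> [[w [wt Bw Awt]]|[bT H]].
- have Nlt : Num.max N w%:num < t%:num.
    by rewrite gt_max; apply/andP; split; [lra|].
  have [n [u [[nu ut]]]] := setC_left t _ t1 Nlt.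
  rewrite gt_max => /andP[Nu wu] tn Xn nX.
  split; first by apply/((HA u (ltW Nu)).2 (nX u nu ut)); apply: Awt.
  have [Nw|wN] := leP N w%:num.
    have [Xw|Xw] := pselect (X w).
    + by right; left; apply/((HB w Nw).1 Xw).
    + by left; apply/((HB w Nw).2 Xw).
  (* Here [w] precedes the tail, so [n] lies between [w] and [t], and [A] at this point of [X] gives
     [a]. *)
  right; right; have Nn : N <= n%:num by lra.
  split; last first.
    exists w; split=> // v wv vN; apply: Awt => //.
    by rewrite ltnngE; lra.
  apply/((HA n Nn).1 Xn); apply: Awt; last exact: lt_trans ut.
  by rewrite ltnngE; lra.
- have Nt' : N < t%:num by lra.
  have [n [u [[nu ut Nu tn Xn] nX]]] := setC_left t _ t1 Nt'.
  have Nn : N <= n%:num by lra.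
  have An v : n < v -> v < t -> A v.
    move=> nv vt; have Nv : N <= v%:num by move: nv; rewrite ltnngE; lra.
    exact/((HA v Nv).2 (nX v nv vt)).
  case: H => [dT|[cT|[aT [w [wN Bw Aw]]]]].
  + exists u; split=> //; first exact/((HB u (ltW Nu)).2 (nX u nu ut)).
    by move=> v uv; apply: An; apply: lt_trans uv.
  + exists n; split=> //; first exact: lt_trans ut.
    exact/((HB n Nn).1 Xn).
  + exists w; split=> //; first by rewrite ltnngE; lra.
    move=> v wv vt; have [Nv|vN] := leP N v%:num; last exact: Aw.
    have [Xv|Xv] := pselect (X v); first exact/((HA v Nv).1 Xv).
    exact/((HA v Nv).2 Xv).
Qed.

Lemma diamond1_determined A :
  eventually_determined X A ->
  eventually_determined X [set t | diamond1_table t A].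
Proof.
move=> [a [b [N [N0 HA]]]].
apply: (eventually_constant (P := a || b) N0) => t Nt /=.
have far u : t < u -> N <= u%:num by rewrite ltnngE; lra.
split=> [[u [tu ut Au]]|abT].
- have [Xu|Xu] := pselect (X u).
  + by apply/orP; left; apply/((HA u (far u tu)).1 Xu).
  + by apply/orP; right; apply/((HA u (far u tu)).2 Xu).
- have [n [tn nt Xn _]] := XP.1 t; case/orP: abT => [aT|bT].
  + by exists n; split=> //; apply/((HA n (far n tn)).1 Xn).
  + have [u [tu un Xu]] := setC_right _ _ tn.
    exists u; split=> //; last exact/((HA u (far u tu)).2 Xu).
    by rewrite ltnngE in un; lra.
Qed.

Lemma past_diamond1_determined A :
  eventually_determined X A ->
  eventually_determined X [set t | past_diamond1_table t A].
Proof.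
move=> [a [b [N [N0 HA]]]]; have N1 : 0 <= N + 1 by lra.
apply: (eventually_constant (P := a || b) N1) => t Nt /=.
have far u : t%:num < u%:num + 1 -> N <= u%:num by lra.
split=> [[u [ut tu Au]]|abT].
- have [Xu|Xu] := pselect (X u).
  + by apply/orP; left; apply/((HA u (far u tu)).1 Xu).
  + by apply/orP; right; apply/((HA u (far u tu)).2 Xu).
- have t1 : 1 <= t%:num by lra.
  have [n [u [[nu ut _ tn Xn] nX]]] := setC_left t (t%:num - 1) t1 ltac:(lra).
  case/orP: abT => [aT|bT].
  + exists n; split=> //; first exact: lt_trans ut.
    exact/((HA n (far n tn)).1 Xn).
  + have tu : t%:num < u%:num + 1 by move: nu; rewrite ltnngE; lra.
    by exists u; split=> //; apply/((HA u (far u tu)).2 (nX u nu ut)).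
Qed.

Lemma qtl_determined (phi : qtl unit) :
  eventually_determined X [set t | holds (fun _ : unit => X) phi t].
Proof.
elim: phi => [|[]|phi|phi IH1 psi IH2|phi IH1 psi IH2|phi IH1 psi IH2|phi|phi].
- exact: (@eventually_constant _ _ _ 0 True).
- by exists true, false, 0; split.
- move=> [a [b [N [N0 H]]]]; exists (~~ a), (~~ b), N; split=> // t Nt /=.
  have [Ha Hb] := H t Nt.
  by split=> Xt; [rewrite -(rwP negP) -(Ha Xt)|rewrite -(rwP negP) -(Hb Xt)].
- have [a [b [c [d [N [N0 HA HB]]]]]] := eventually_determined2 IH1 IH2.
  exists (a && c), (b && d), N; split=> // t Nt /=.
  have [[Aa Ab] [Ba Bb]] := (HA t Nt, HB t Nt).
  split=> Xt; rewrite -(rwP andP).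
  + by rewrite -(Aa Xt) -(Ba Xt).
  + by rewrite -(Ab Xt) -(Bb Xt).
- exact: until_determined.
- exact: since_determined.
- exact: diamond1_determined.
- exact: past_diamond1_determined.
Qed.

End ShortGaps.

(** * The multiples of 2/3 *)

Definition grid (R : realType) : set {nonneg R} :=
  [set t | exists k : nat, t%:num = k%:R * (2 / 3)].

Lemma grid_gap {R : realType} (t : {nonneg R}) (k : nat) :
  k%:R * (2 / 3) < t%:num -> t%:num < k.+1%:R * (2 / 3) -> ~ grid R t.
Proof.
move=> kt tk [m tm]; rewrite tm !ltr_pM2r ?ltr_nat ?ltnS in kt tk; try by lra.
by rewrite ltnNge tk in kt.
Qed.

Lemma short_gaps_grid {R : realType} : short_gaps (grid R).
Proof.
have floor (t : {nonneg R}) : exists k : nat,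
    k%:R * (2 / 3) <= t%:num < k.+1%:R * (2 / 3).
  have x0 : 0 <= t%:num / (2 / 3) :> R by [].
  have /andP[lo hi] := truncn_itv x0.
  exists (Num.truncn (t%:num / (2 / 3) : R)).
  by rewrite -ler_pdivlMr -?ltr_pdivrMr ?lo ?hi //; lra.
split=> t.
- have [k /andP[kt tk]] := floor t.
  have [n nE] := @nng_ex R (k.+1%:R * (2 / 3)) ltac:(by []).
  have kS := @natr1 R k.
  exists n; split; [rewrite ltnngE; lra|lra|by exists k.+1|].
  by move=> u; rewrite !ltnngE => tu un; apply: (@grid_gap _ _ k); lra.
- move=> t1; have [k /andP[kt tk]] := floor t.
  (* If [t] is itself on the grid, the previous point has index one less than the floor; [1 <= t]
     excludes index 0. *)
  have [j [jt tj]] : exists j : nat,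
      j%:R * (2 / 3) < t%:num /\ t%:num <= j.+1%:R * (2 / 3).
    move: kt; rewrite le_eqVlt => /orP[/eqP kt|kt].
      by case: k kt tk => [|j] kt tk; [lra|exists j; rewrite -kt -natr1; lra].
    by exists k; split=> //; apply: ltW.
  have [n nE] := @nng_ex R (j%:R * (2 / 3)) ltac:(by []).
  have jS := @natr1 R j.
  exists n; split; [rewrite ltnngE; lra|lra|by exists j|].
  by move=> u; rewrite !ltnngE => tu un; apply: (@grid_gap _ _ j); lra.
Qed.

(* [qtl unit]: formulas with a single predicate name, interpreted by [X]. *)
Theorem theorem3p2 (R : realType) :
  ~ exists phi : qtl unit,
      forall (X : set {nonneg R}) (t : {nonneg R}),
        holds (fun _ : unit => X) phi t <-> counting_table 2 t X.
Proof.
move=> [phi phiP].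
have [a [b [N [N0 H]]]] := qtl_determined (@short_gaps_grid R) phi.
pose k := (Num.truncn (N * 2)).+1.
have Nk : N <= k%:R * (2 / 3).
  by have := truncnS_gt (N * 2); rewrite -/k; lra.
have kS1 := @natr1 R k; have kS2 := @natr1 R k.+1.
(* The next two grid points are at distances 1/2 and 7/6 from [t], but 1/6 and 5/6 from [s]. *)
have [t tE] := @nng_ex R (k%:R * (2 / 3) + 1 / 6) ltac:(lra).
have [s sE] := @nng_ex R (k%:R * (2 / 3) + 1 / 2) ltac:(lra).
have Xt : ~ grid R t by apply: (@grid_gap _ _ k); lra.
have Xs : ~ grid R s by apply: (@grid_gap _ _ k); lra.
have Ht := (H t ltac:(lra)).2 Xt; have Hs := (H s ltac:(lra)).2 Xs.
have : counting_table 2 s (grid R).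
  have [p pE] := @nng_ex R (k.+1%:R * (2 / 3)) ltac:(by []).
  have [q qE] := @nng_ex R (k.+2%:R * (2 / 3)) ltac:(by []).
  have pq : p < q by rewrite ltnngE; lra.
  exists (fun i : 'I_2 => if i == ord0 then p else q); split=> [i j|i].
    case: eqP => [->|/eqP i0]; case: eqP => [->|/eqP j0] // e.
    - by rewrite e ltxx in pq.
    - by rewrite e ltxx in pq.
    - by apply: val_inj; case: i j i0 j0 {e} => [[|[|i]] ?] [[|[|j]] ?].
  case: eqP => _; (split; [rewrite ltnngE; lra|lra|]).
  - by exists k.+1.
  - by exists k.+2.
(* Both points are outside the grid, so [phi] has the value [b] at each, and [C_2] passes from [s]
   to [t]. *)
rewrite -phiP => /Hs /Ht /phiP[f [f_inj fP]].
(* Only one grid point is within reach of [t], so [f] is constant, against injectivity. *)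
suff fE i : (f i)%:num = k.+1%:R * (2 / 3).
  have /f_inj // : f ord0 = f ord_max by apply: val_inj; rewrite /= !fE.
have [] := fP i; rewrite ltnngE => tf ft [m fm]; rewrite fm; congr (_%:R * _).
have km : (k < m)%N by rewrite -(ltr_nat R); lra.
have mk : (m < k.+2)%N by rewrite -(ltr_nat R); lra.
by apply/eqP; rewrite eqn_leq km -ltnS mk.
Qed.
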